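(* Let $Q\subseteq\mathbb{R}$ be an interval. (a) Let $f,F:Q\to\mathbb{R}$. If $f$ is the derivative of $F$ on $Q$ (in the sense of the context), then for all $u\in Q$ and all $v\in Q$, $$\int_u^v f(x)\,dx = F(v)-F(u).$$ (b) Vice versa, let $f:Q\to\mathbb{R}$. If $f$ has a unique integral system $S(u,v)=\int_u^v f(x)\,dx$ on $Q$, then for any fixed $u\in Q$ the function $F(x)=S(u,x)=\int_u^x f(t)\,dt$ has $f$ as its derivative on $Q$ (in the sense of the context).
   Context: All functions are real-valued. The notions below are not the usual limit-based ones. Control function: let $F,f$ be functions defined on a set $S\subseteq\mathbb{R}$. $f$ is a (difference-quotient) control function of $F$ on $S$ if for any two points $u<v$ in $S$ there are $p,q\in[u,v]\cap S$ such that $f(p)\le \frac{F(v)-F(u)}{v-u}\le f(q)$. Derivative: let $f$ be a control function of $F$ on an interval $Q$. If every function $G$ on $Q$ that has $f$ as a control function on $Q$ is of the form $G(x)=F(x)+C$ on $Q$ for some constant $C$, then $f$ is said to be the derivative of $F$ on $Q$. Integral system: let $Q$ be an interval, $f:Q\to\mathbb{R}$ and $S:Q\times Q\to\mathbb{R}$. $S$ is an integral system of $f$ on $Q$ if (i) $S(u,v)+S(v,w)=S(u,w)$ for all $u,v,w\in Q$; and (ii) for all $u<v$ in $Q$ there exist $p,q\in[u,v]$ such that $f(p)(v-u)\le S(u,v)\le f(q)(v-u)$. Definite integral: if $f$ has a unique integral system $S$ on $Q$, then $f$ is said to be integrable on $Q$, and one writes $\int_u^v f(x)\,dx=S(u,v)$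 for $u,v\in Q$. An equation involving $\int_u^v f(x)\,dx$ includes the assertion that $f$ is integrable on $Q$ in this sense. *)

(* Defs.v *)
From HB Require Import structures.
From mathcomp Require Import all_boot all_order all_algebra.
From mathcomp Require Import all_classical all_reals normedtype.

Set Implicit Arguments.
Unset Strict Implicit.
Unset Printing Implicit Defensive.

Import Order.TTheory GRing.Theory Num.Theory.

Local Open Scope classical_set_scope.
Local Open Scope ring_scope.

(* A function on Q is represented by a total function of which only the values
   on Q matter; accordingly, functions on Q (or on Q * Q) are compared on Q
   only. *)

Definition control_function (R : realType) (Q : set R) (f F : R -> R) : Prop :=
  forall u v : R, Q u -> Q v -> u < v ->
    exists p q : R,
      [/\ (`[u, v] `&` Q) p, (`[u, v] `&` Q) q &
          f p <= (F v - F u) / (v - u) <= f q].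

(* "f is the derivative of F on Q"; this is not the limit-based notion. *)
Definition is_derivative_of (R : realType) (Q : set R) (f F : R -> R) : Prop :=
  control_function Q f F /\
  forall G : R -> R, control_function Q f G ->
    exists C : R, forall x : R, Q x -> G x = F x + C.

Definition integral_system
    (R : realType) (Q : set R) (f : R -> R) (S : R -> R -> R) : Prop :=
  (forall u v w : R, Q u -> Q v -> Q w -> S u v + S v w = S u w) /\
  (forall u v : R, Q u -> Q v -> u < v ->
    exists p q : R,
      [/\ `[u, v]%classic p, `[u, v]%classic q &
          f p * (v - u) <= S u v <= f q * (v - u)]).

Definition unique_integral_system
    (R : realType) (Q : set R) (f : R -> R) (S : R -> R -> R) : Prop :=
  integral_system Q f S /\
  forall T : R -> R -> R, integral_system Q f T ->
    forall u v : R, Q u -> Q v -> T u v = S u v.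

Definition integrable_on (R : realType) (Q : set R) (f : R -> R) : Prop :=
  exists S : R -> R -> R, unique_integral_system Q f S.

(* The value at (u, v) of a chosen unique integral system of f on Q;
   meaningful only if f is integrable on Q and u, v are in Q, in which case it
   does not depend on the choice (definite_integralE). *)
Definition definite_integral
    (R : realType) (Q : set R) (f : R -> R) (u v : R) : R :=
  xget (fun _ _ => 0) [set S | unique_integral_system Q f S] u v.

Lemma definite_integralE (R : realType) (Q : set R) (f : R -> R)
    (S : R -> R -> R) (u v : R) :
  unique_integral_system Q f S -> Q u -> Q v ->
  definite_integral Q f u v = S u v.
Proof.
move=> HS Qu Qv; rewrite /definite_integral.
case: xgetP => [T _ [HT _]|/(_ S)]; last by move=> /(_ HS).
by case: HS => _; apply.
Qed.

(* Main.v *)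
Require Import Defs.
From HB Require Import structures.
From mathcomp Require Import all_boot all_order all_algebra.
From mathcomp Require Import all_classical all_reals normedtype.

Set Implicit Arguments.
Unset Strict Implicit.
Unset Printing Implicit Defensive.

Import Order.TTheory GRing.Theory Num.Theory.

Local Open Scope classical_set_scope.
Local Open Scope ring_scope.

(** Integral systems of [f] are the same objects as functions controlled by [f],
    taken up to an additive constant.  Multiplying the bounds on the difference
    quotient of [F] by [v - u] turns them into the bounds required of the
    increments [F v - F u] ([integral_system_increment]), and conversely every
    integral system is the system of increments of its own section
    [x |-> S a x] ([integral_system_subr]), which is therefore controlled by [f]
    ([control_function_section]).  Under this correspondence, uniqueness of the
    integral system is uniqueness of the controlled function up to a constant,
    which is what both halves of the theorem assert. *)

(** Convexity of [Q] is what places the points of [[u, v]] supplied by an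
    integral system inside [Q], as a control function demands. *)
Lemma integral_system_increment (R : realType) (Q : set R) (f F : R -> R) :
  is_interval Q ->
  integral_system Q f (fun u v => F v - F u) <-> control_function Q f F.
Proof.
move=> hQ; split=> [[_ bnd] u v Qu Qv uv|ctl].
  have [p [q [Ip Iq fpq]]] := bnd _ _ Qu Qv uv.
  have sub z : `[u, v]%classic z -> (`[u, v] `&` Q) z.
    move=> Iz; split=> //; move: Iz; rewrite /= in_itv /=.
    exact: hQ Qu Qv _.
  exists p, q; split; [exact: sub|exact: sub|].
  by rewrite ler_pdivlMr ?ler_pdivrMr ?subr_gt0.
split=> [u v w _ _ _|u v Qu Qv uv]; first by rewrite addrC subrKA.
have [p [q [[Ip _] [Iq _] fpq]]] := ctl _ _ Qu Qv uv.
exists p, q; split=> //.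
by move: fpq; rewrite ler_pdivlMr ?ler_pdivrMr ?subr_gt0.
Qed.

Lemma integral_system_subr (R : realType) (Q : set R) (f : R -> R)
    (S : R -> R -> R) (a u v : R) :
  integral_system Q f S -> Q a -> Q u -> Q v -> S u v = S a v - S a u.
Proof. by move=> [add _] Qa Qu Qv; rewrite -(add a u v)// addrC addKr. Qed.

Lemma control_function_section (R : realType) (Q : set R) (f : R -> R)
    (S : R -> R -> R) (a : R) :
  is_interval Q -> integral_system Q f S -> Q a -> control_function Q f (S a).
Proof.
move=> hQ HS Qa; apply/(integral_system_increment f (S a) hQ).
split=> [u v w _ _ _|u v Qu Qv uv]; first by rewrite addrC subrKA.
by rewrite -(integral_system_subr HS Qa Qu Qv); case: HS => _; apply.
Qed.

(** Any other integral system has a controlled section, which differs from [F]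
    by a constant; constants disappear in increments. *)
Lemma derivative_unique_integral_system (R : realType) (Q : set R)
    (f F : R -> R) :
  is_interval Q -> is_derivative_of Q f F ->
  unique_integral_system Q f (fun u v => F v - F u).
Proof.
move=> hQ [ctl uniq]; split; first exact/integral_system_increment.
move=> T HT u v Qu Qv.
have [C TE] := uniq _ (control_function_section hQ HT Qu).
by rewrite (integral_system_subr HT Qu Qu Qv) !TE// opprD addrACA subrr addr0.
Qed.

(** A function [G] controlled by [f] has the same increments as [S], so the
    constant is the value of [G] at the base point. *)
Lemma unique_integral_system_derivative (R : realType) (Q : set R)
    (f : R -> R) (S : R -> R -> R) (a : R) :
  is_interval Q -> unique_integral_system Q f S -> Q a ->
  is_derivative_of Q f (S a).
Proof.
move=> hQ [HS uniq] Qa; split; first exact: control_function_section.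
move=> G /(integral_system_increment _ _ hQ) HG; exists (G a) => x Qx.
by rewrite -(uniq _ HG _ _ Qa Qx) subrK.
Qed.

Theorem proposition3 (R : realType) (Q : set R) (hQ : is_interval Q) :
  (forall f F : R -> R, is_derivative_of Q f F ->
     integrable_on Q f /\
     (forall u v : R, Q u -> Q v -> definite_integral Q f u v = F v - F u))
  /\
  (forall (f : R -> R) (S : R -> R -> R), unique_integral_system Q f S ->
     forall u : R, Q u ->
       (forall x : R, Q x -> S u x = definite_integral Q f u x) /\
       is_derivative_of Q f (fun x => S u x)).
Proof.
split=> [f F /(derivative_unique_integral_system hQ) HS|f S HS u Qu].
  by split=> [|u v Qu Qv]; [exists (fun u v => F v - F u)
                           |rewrite (definite_integralE HS)].
split=> [x Qx|]; first by rewrite (definite_integralE HS).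
exact: unique_integral_system_derivative.
Qed.
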